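(* Let $n,m\ge 2$, let $G=B(n,m)$ be the broom graph on the vertex set $V(G)=\{x_1,\ldots,x_n,y_1,\ldots,y_m\}$, and let $NI(G^2)\subset S=K[V(G)]$ be the closed neighborhood ideal of the square of $G$. Write $m-2=6p''+d''$ with $p''\geq 0$ and $0\leq d''\leq 5$. Then $$\operatorname{reg}\frac{S}{NI(G^2)}=\begin{cases} 4p''+n+1, & d''\in\{0,1\}\\ 4p''+n+2, & d''=2\\ 4p''+n+3, & d''\in\{3,4\}\\ 4p''+n+4, & d''=5\end{cases}$$ and $$\operatorname{pd}\frac{S}{NI(G^2)}=\begin{cases} 2p''+1, & d''=0\\ 2p''+2, & d''\in\{1,2,3\}\\ 2p''+3, & d''\in\{4,5\}.\end{cases}$$
   Context: $K$ is a field. For $n,m\ge 2$, the broom graph $G=B(n,m)$ is the simple graph with vertex set $V(G)=\{x_1,\ldots,x_n,y_1,\ldots,y_m\}$ and edge set $E(G)=\{\{x_i,y_1\}:1\le i\le n\}\cup\{\{y_j,y_{j+1}\}:1\le j\le m-1\}$. Its square $G^2$ is the graph on the same vertex set with edge set $E(G^2)=E(G)\cup\{\{x_i,x_j\}:1\le i<j\le n\}\cup\{\{x_i,y_2\}:1\le i\le n\}\cup\{\{y_j,y_{j+2}\}:1\le j\le m-2\}$. For a simple graph $H$ and a vertex $u$, the closed neighborhood is $N[u]=\{u\}\cup\{v:\{u,v\}\in E(H)\}$. The closed neighborhood ideal $NI(H)$ is the squarefree monomial ideal of the polynomial ring $K[V(H)]$ (whose variables are the vertices) generated by the monomials $\prod_{v\in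 N[u]}v$, for $u\in V(H)$. The ring $S$ is standard graded. For a homogeneous ideal $I\subset S$ with graded Betti numbers $\beta_{ij}$ of the minimal graded free resolution of $S/I$, $\operatorname{pd}(S/I)=\max\{i:\beta_{ij}\ne0\}$ and $\operatorname{reg}(S/I)=\max\{j-i:\beta_{ij}\neq 0\}$ (Castelnuovo--Mumford regularity). *)

(* Defs.v *)
From HB Require Import structures.
From mathcomp Require Import all_boot all_order all_algebra.
From mathcomp Require Import mpoly.

Set Implicit Arguments.
Unset Strict Implicit.
Unset Printing Implicit Defensive.

Import Order.TTheory GRing.Theory Num.Theory.
Local Open Scope ring_scope.

(** * Graded free resolutions *)

Definition ideal_generated (R : comNzRingType) (I : finType) (f : I -> R)
  (p : R) : Prop :=
  exists c : I -> R, p = \sum_(i : I) c i * f i.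

(* A sequence of graded free modules F_i = \bigoplus_k S(- fshift i k), with
   k < frank i and S = K[X_0, ..., X_(N-1)], together with degree-preserving
   maps fdiff i : F_(i+1) -> F_i and faug : F_0 -> S. Elements of F_i are row
   vectors and maps act by right multiplication.
   The shifts may be taken in nat: the graded module S/I lives in nonnegative
   degrees, hence so do the generators in its minimal resolution.
   The entry of fdiff i at (k, l) is homogeneous of degree
   fshift i.+1 k - fshift i l, hence zero when this is negative. *)
Record graded_free_seq (K : fieldType) (N : nat) := GradedFreeSeq {
  frank  : nat -> nat;
  fshift : forall i, 'I_(frank i) -> nat;
  fdiff  : forall i, 'M[{mpoly K[N]}]_(frank i.+1, frank i);
  faug   : 'cV[{mpoly K[N]}]_(frank 0);
  fdiff_homog : forall i k l, fdiff i k l != 0 ->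
    exists2 e, fshift k = (fshift l + e)%N & fdiff i k l \is e.-homog;
  faug_homog : forall k, faug k 0 \is (fshift k).-homog
}.

Arguments fshift {K N} g i k.

Section Resolution.
Variables (K : fieldType) (N : nat).
Implicit Types (I : {mpoly K[N]} -> Prop) (F : graded_free_seq K N).

(* ... -> F_1 -> F_0 -> S/I -> 0 is exact, where the last map is faug followed
   by the projection S -> S/I. *)
Definition resolution_of_quotient I F : Prop :=
  [/\ forall p, exists u : 'rV_(frank F 0), I (p - (u *m faug F) 0 0),
      forall u : 'rV_(frank F 0),
        I ((u *m faug F) 0 0) <-> exists w, u = w *m fdiff F 0
    & forall i (u : 'rV_(frank F i.+1)),
        u *m fdiff F i = 0 <-> exists w, u = w *m fdiff F i.+1].

(* im (F_(i+1) -> F_i) is contained in (X_0, ..., X_(N-1)) F_i. *)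
Definition minimal_complex F : Prop :=
  forall i k l, (fdiff F i k l)@_0%MM = 0.

Definition minimal_graded_free_resolution I F : Prop :=
  resolution_of_quotient I F /\ minimal_complex F.

Definition betti F (i j : nat) : nat := #|[set k | fshift F i k == j]|.

End Resolution.

Definition is_max d (T : porderType d) (A : T -> Prop) (r : T) : Prop :=
  A r /\ forall s, A s -> (s <= r)%O.

(* For a homogeneous ideal I the minimal graded free resolution of S/I is unique
   up to isomorphism, so its Betti numbers may be read off from any one. *)
Definition pd_quotient_is (K : fieldType) (N : nat) (I : {mpoly K[N]} -> Prop)
  (r : nat) : Prop :=
  exists2 F, minimal_graded_free_resolution I F
    & is_max (fun i : nat => exists j, betti F i j != 0%N) r.

Definition reg_quotient_is (K : fieldType) (N : nat) (I : {mpoly K[N]} -> Prop)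
  (r : int) : Prop :=
  exists2 F, minimal_graded_free_resolution I F
    & is_max (fun s : int =>
                exists i j : nat, betti F i j != 0%N /\ s = j%:Z - i%:Z) r.

(** * Closed neighborhood ideals *)

Definition closed_nbhd (V : finType) (e : rel V) (u : V) : {set V} :=
  [set v | (v == u) || e u v].

(* K[V] is {mpoly K[#|V|]}, the vertex v being the variable 'X_(enum_rank v). *)
Definition NI (K : fieldType) (V : finType) (e : rel V)
  : {mpoly K[#|V|]} -> Prop :=
  ideal_generated (fun u : V =>
    \prod_(v in closed_nbhd e u) ('X_(enum_rank v) : {mpoly K[#|V|]})).

Arguments NI K {V} e p.

(** * The broom graph and its square *)

(* inl i stands for x_(i+1) and inr j for y_(j+1). *)
Definition broom_vertex (n m : nat) : finType := ('I_n + 'I_m)%type.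

Definition sym_closure (V : Type) (e : rel V) : rel V :=
  fun u v => e u v || e v u.

Definition broom_arc (n m : nat) : rel (broom_vertex n m) := fun u v =>
  match u, v with
  | inl _, inr j => val j == 0%N
  | inr j, inr k => val k == j.+1
  | _, _ => false
  end.

Definition broom_sq_extra_arc (n m : nat) : rel (broom_vertex n m) := fun u v =>
  match u, v with
  | inl i, inl i' => (i < i')%N
  | inl _, inr j => val j == 1%N
  | inr j, inr k => val k == j.+2
  | _, _ => false
  end.

Definition broom (n m : nat) : rel (broom_vertex n m) :=
  sym_closure (@broom_arc n m).

Definition broom_sq (n m : nat) : rel (broom_vertex n m) := fun u v =>
  broom u v || sym_closure (@broom_sq_extra_arc n m) u v.

Arguments broom n m u v : clear implicits.
Arguments broom_sq n m u v : clear implicits.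

Lemma broom_sym n m : ssrbool.symmetric (broom n m).
Proof. by move=> u v; rewrite /broom /sym_closure orbC. Qed.

Lemma broom_irr n m : irreflexive (broom n m).
Proof. by case=> [i|j]; rewrite /broom /sym_closure //= orbb ltn_eqF. Qed.

Lemma broom_sq_sym n m : ssrbool.symmetric (broom_sq n m).
Proof. by move=> u v; rewrite /broom_sq broom_sym /sym_closure [X in _ || X]orbC. Qed.

Lemma broom_sq_irr n m : irreflexive (broom_sq n m).
Proof.
move=> u; rewrite /broom_sq broom_irr; case: u => [i|j].
  by rewrite /sym_closure /= ltnn.
by rewrite /sym_closure /= orbb ltn_eqF // leqnSn.
Qed.

(* broom_sq joins the vertices at distance 1 or 2 in broom. *)
Lemma broom_sqE n m (u v : broom_vertex n m) : (2 <= m)%N ->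
  broom_sq n m u v =
  (u != v) && (broom n m u v || [exists w, broom n m u w && broom n m w v]).
Proof.
move=> m_ge2; have m_gt0 : (0 < m)%N by apply: leq_trans m_ge2.
pose y0 : 'I_m := Ordinal m_gt0.
have yP k (j : 'I_m) : (k <= j)%N -> (k < m)%N.
  by move=> lekj; apply: leq_ltn_trans lekj (ltn_ord j).
have W (a w b : broom_vertex n m) :
    broom n m a w -> broom n m w b -> [exists w, broom n m a w && broom n m w b].
  by move=> aw wb; apply/existsP; exists w; rewrite aw.
have sq_arc (a b : broom_vertex n m) : broom_sq_extra_arc a b ->
    (a != b) && (broom n m a b || [exists w, broom n m a w && broom n m w b]).
  case: a b => [i|j] [i'|k] //=.
  - move=> ltii'; apply/andP; split.
      by apply: contraTneq ltii' => -[->]; rewrite ltnn.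
    by rewrite (W _ (inr y0) _) ?orbT.
  - move=> k1; rewrite (W _ (inr y0) _) ?orbT //.
    by rewrite /broom /sym_closure /= k1.
  - move=> kj; have jm : (j.+1 < m)%N by apply: (yP _ k); rewrite (eqP kj).
    apply/andP; split; last first.
      rewrite (W _ (inr (Ordinal jm)) _) ?orbT //.
        by rewrite /broom /sym_closure /= eqxx.
      by rewrite /broom /sym_closure /= kj.
    by apply: contraTneq kj => -[->]; rewrite ltn_eqF // leqnSn.
apply/idP/idP.
  case/orP=> [uv|/orP[/sq_arc //|/sq_arc]].
    by rewrite uv andbT; apply: contraTneq uv => ->; rewrite broom_irr.
  rewrite eq_sym broom_sym => /andP[-> /orP[->//|/existsP[w /andP[vw wu]]]].
  by rewrite (W _ w) ?orbT // broom_sym.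
rewrite /broom_sq => /andP[neq_uv /orP[->//|/existsP[w]]].
case: u v w neq_uv => [i|j] [i'|k] [i''|l] //=;
  rewrite /broom /sym_closure /= ?orbF ?andbF //.
- by move=> neq _; rewrite -neq_ltn; apply: contra neq => /eqP/val_inj->.
- by move=> _ /andP[/eqP-> /orP[->|//]]; rewrite orbT.
- by move=> _ /andP[/orP[/eqP-> //|/eqP->] /eqP->]; rewrite orbT.
- move=> neq /andP[/eqP j0 /eqP k0]; case/eqP: neq; congr inr.
  by apply: val_inj; rewrite /= j0 k0.
move=> neq; have njk : val j != val k by apply: contra neq => /eqP/val_inj->.
case/andP=> /orP[/eqP lj|/eqP jl] /orP[/eqP kl|/eqP lk].
- by rewrite kl lj eqxx !orbT.
- by move: njk; rewrite /= -eqSS -lj -lk eqxx.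
- by move: njk; rewrite /= jl kl eqxx.
- by rewrite jl lk eqxx !orbT.
Qed.

(* Main.v *)
Require Import Defs.
From mathcomp Require Import all_boot all_order all_algebra.
From mathcomp Require Import mpoly.
From mathcomp Require Import zify.
From Stdlib Require Import ClassicalEpsilon.

Set Implicit Arguments.
Unset Strict Implicit.
Unset Printing Implicit Defensive.

Import GRing.Theory.

(** Number the y-vertices from 0 and list the vertices on a line, the x's
    first.  The minimal generators of the ideal are then products of vertices
    over intervals: the interval made of all x's, y_0 and y_1; the windows
    y_j, ..., y_(j+4) for j < m - 5; and, for m >= 3, the final triple
    y_(m-3) y_(m-2) y_(m-1).

    Add these generators from left to right.  Each new monomial f contains a
    variable v, its right end, that does not occur in the ideal J built so
    far; so v is a nonzerodivisor modulo J and, with f = v g, the colon ideals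
    J : f and J : g agree.  Multiplication by g lifts to a chain map from a
    minimal resolution of S/(J : f) to one of S/J, and v times this lift is a
    lift of multiplication by f whose entries all lie in the maximal ideal.
    Its mapping cone is therefore a minimal resolution of S/(J + (f)), whence
      pd S/(J + (f)) = max (pd S/J, pd S/(J : f) + 1)
      reg S/(J + (f)) = max (reg S/J, reg S/(J : f) + deg f - 1)
    (pd_reg_cone, and pd_reg_add_monomial for squarefree monomial ideals).

    The colon ideals stay in the same family.  Let W_k be generated by the
    x-interval and the first k windows.  Then W_k : (y_k ... y_(k+4)) is
    (y_(k-1)) + W_(k-5), because every window that meets the new one and
    avoids y_(k-1) would have to start after it (windows_colon).  If D_c is
    the ideal for c >= 3 y-vertices, then D_c = W_(c-5) + (y_(c-3) y_(c-2) y_(c-1))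
    and W_(c-5) : (y_(c-3) y_(c-2) y_(c-1)) = D_(c-3), because the window that
    ends just before y_(c-1) leaves exactly the triple before the last one
    (broom_colon).  To make this hold down to c = 3, D_c is the principal ideal
    (x_1 ... x_n y_0 ... y_(c-1)) for c < 3.

    The second recursion adds 1 to pd and 2 to reg at each step of length 3,
    which gives pd = c / 3 + 1 and reg = n - 1 + 2 (c / 3) + c mod 3 as long as
    W_(c-5) does not exceed these values; the first recursion shows that it
    does not (windows_pd_reg).  Substituting c = m = 6 p + d + 2 yields the
    two case distinctions. *)

(** * Graded matrices and lifting *)

Section GradedAlgebra.
Local Open Scope ring_scope.
Variables (K : fieldType) (N : nat).
Implicit Types (p q : {mpoly K[N]}) (J : {mpoly K[N]} -> Prop).
Implicit Types F : graded_free_seq K N.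

(** The coordinate, on a free generator of degree s, of the degree D part of a
    vector: the guard is the vanishing of S in negative degrees. *)
Definition degpart (s D : nat) p : {mpoly K[N]} :=
  if (s <= D)%N then pihomog mdeg (D - s) p else 0.

Lemma degpart_sum (I : Type) (r : seq I) (f : I -> {mpoly K[N]}) s D :
  degpart s D (\sum_(i <- r) f i) = \sum_(i <- r) degpart s D (f i).
Proof.
rewrite /degpart; case: ifP => _; first by rewrite raddf_sum.
by rewrite big1_eq.
Qed.

Lemma degpartZ s D c p : degpart s D (c *: p) = c *: degpart s D p.
Proof. by rewrite /degpart; case: ifP => _; rewrite ?linearZ ?scaler0. Qed.

Lemma degpart0 s D : degpart s D 0 = 0.
Proof. by rewrite /degpart pihomog0 if_same. Qed.

Lemma degpart_homog s D e p :
  p \is e.-homog -> degpart s D p = if (s + e == D)%N then p else 0.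
Proof.
move=> hp; rewrite /degpart; case: leqP => [le_sD|lt_Ds].
  case: eqP => [<-|ne]; first by rewrite addKn pihomog_dE.
  by apply: pihomog_ne0 hp; apply/eqP; lia.
by case: eqP => // ?; lia.
Qed.

Lemma degpartM s D e p q :
  q \is e.-homog -> degpart s D (p * q) = degpart (s + e) D p * q.
Proof.
move=> hq; rewrite {1 2}(mpolyE p) mulr_suml !degpart_sum mulr_suml.
apply: eq_bigr => m _; rewrite -scalerAl !degpartZ -scalerAl; congr (_ *: _).
have hm : ('X_[m] : {mpoly K[N]}) \is (mdeg m).-homog by rewrite dhomogX.
rewrite (degpart_homog _ _ (dhomogM hm hq)) (degpart_homog _ _ hm).
by rewrite addnA addnAC; case: ifP; rewrite ?mul0r.
Qed.

(** The same condition as in the homogeneity field of a graded sequence, for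
    arbitrary row and column degrees. *)
Definition graded_mx a b (s : 'I_a -> nat) (t : 'I_b -> nat)
    (M : 'M[{mpoly K[N]}]_(a, b)) :=
  forall k l, M k l != 0 -> exists2 e, s k = (t l + e)%N & M k l \is e.-homog.

Definition degpart_row a (s : 'I_a -> nat) D (u : 'rV[{mpoly K[N]}]_a) :=
  \row_k degpart (s k) D (u 0 k).

(** Graded matrices commute with taking the degree D part of a vector; this is
    what turns arbitrary lifts into graded ones. *)
Lemma degpart_rowM a b (s : 'I_a -> nat) (t : 'I_b -> nat) M D u :
  graded_mx s t M -> degpart_row s D u *m M = degpart_row t D (u *m M).
Proof.
move=> gM; apply/rowP => l; rewrite !mxE degpart_sum; apply: eq_bigr => k _.
rewrite mxE; have [->|/gM[e -> he]] := eqVneq (M k l) 0; last first.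
  by rewrite (degpartM _ _ _ he).
by rewrite !mulr0 degpart0.
Qed.

Lemma degpart_rowP a b (r : 'I_a -> nat) (t : 'I_b -> nat) M k :
  graded_mx r t M -> degpart_row t (r k) (row k M) = row k M.
Proof.
move=> gM; apply/rowP => l; rewrite !mxE.
have [->|/gM[e -> he]] := eqVneq (M k l) 0; last by rewrite (degpart_homog _ _ he) eqxx.
by rewrite degpart0.
Qed.

Lemma graded_mx_degpart a b (r : 'I_a -> nat) (t : 'I_b -> nat)
    (u : 'I_a -> 'rV[{mpoly K[N]}]_b) :
  graded_mx r t (\matrix_k degpart_row t (r k) (u k)).
Proof.
move=> k l; rewrite !mxE /degpart; case: leqP => [le|]; last by rewrite eqxx.
by move=> _; exists (r k - t l)%N; [lia | exact: pihomogP].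
Qed.

Lemma graded_mulmx a1 a2 a3 (r : 'I_a1 -> nat) (s : 'I_a2 -> nat)
    (t : 'I_a3 -> nat) (A : 'M_(a1, a2)) (B : 'M_(a2, a3)) :
  graded_mx r s A -> graded_mx s t B -> graded_mx r t (A *m B).
Proof.
move=> gA gB k l; rewrite !mxE.
have -> : \sum_j A k j * B j l = degpart (t l) (r k) (\sum_j A k j * B j l).
  rewrite degpart_sum; apply: eq_bigr => j _.
  have [->|/gA[e -> he]] := eqVneq (A k j) 0.
    by rewrite mul0r degpart0.
  have [->|/gB[e' -> he']] := eqVneq (B j l) 0.
    by rewrite mulr0 degpart0.
  by rewrite (degpart_homog _ _ (dhomogM he he')) addnA addnAC eqxx.
rewrite /degpart; case: leqP => [le|]; last by rewrite eqxx.
by move=> _; exists (r k - t l)%N; [lia | exact: pihomogP].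
Qed.

(** The exactness conditions give lifts without control of degrees; the part
    of the right degree of a lift is again a lift. *)
Lemma graded_lift a b c (r : 'I_c -> nat) (s : 'I_a -> nat) (t : 'I_b -> nat)
    (M : 'M_(a, b)) (U : 'M_(c, b)) :
  graded_mx s t M -> graded_mx r t U ->
  (forall k, exists w, row k U = w *m M) ->
  exists2 W, graded_mx r s W & W *m M = U.
Proof.
move=> gM gU /fin_all_exists[u uP].
exists (\matrix_k degpart_row s (r k) (u k)); first exact: graded_mx_degpart.
apply/row_matrixP => k; rewrite row_mul rowK (degpart_rowM _ _ gM) -uP.
exact: degpart_rowP.
Qed.

Definition graded_ideal J :=
  [/\ J 0, forall p q, J p -> J q -> J (p + q), forall c p, J p -> J (c * p)
    & forall e p, J p -> J (pihomog mdeg e p)].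

Lemma graded_ideal_degpart J s D p : graded_ideal J -> J p -> J (degpart s D p).
Proof. by case=> J0 _ _ Jh Jp; rewrite /degpart; case: ifP => _ //; exact: Jh. Qed.

Lemma graded_idealN J p : graded_ideal J -> J p -> J (- p).
Proof. by case=> _ _ JM _ Jp; rewrite -mulN1r; exact: JM. Qed.

Lemma graded_ideal_sum J (I : finType) (f : I -> {mpoly K[N]}) :
  graded_ideal J -> (forall i, J (f i)) -> J (\sum_i f i).
Proof. by case=> J0 JD _ _ Jf; elim/big_ind: _. Qed.

Lemma graded_fdiff F i : graded_mx (fshift F i.+1) (fshift F i) (fdiff F i).
Proof. exact: fdiff_homog. Qed.

Lemma graded_faug F : graded_mx (fshift F 0) (fun=> 0%N) (faug F).
Proof.
by move=> k l _; exists (fshift F 0 k); rewrite ?add0n // (ord1 l); exact: faug_homog.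
Qed.

Lemma fdiffK (L : {mpoly K[N]} -> Prop) (G : graded_free_seq K N) i :
  resolution_of_quotient L G -> fdiff G i.+1 *m fdiff G i = 0.
Proof.
case=> _ _ exG; apply/row_matrixP => l; rewrite row_mul row0.
by apply/exG; exists (delta_mx 0 l); rewrite -rowE.
Qed.

(** * Lifting a multiplication to a chain map *)

Section Comparison.
Variables (J J' : {mpoly K[N]} -> Prop) (F F' : graded_free_seq K N).
Variables (g : {mpoly K[N]}) (dg : nat).
Hypotheses (idJ : graded_ideal J) (resF : resolution_of_quotient J F).
Hypotheses (resF' : resolution_of_quotient J' F').
Hypotheses (hg : g \is dg.-homog) (J'J : forall p, J' p -> J (p * g)).

Let shift' i (k : 'I_(frank F' i)) := (fshift F' i k + dg)%N.

Lemma graded_shift i : graded_mx (@shift' i.+1) (@shift' i) (fdiff F' i).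
Proof.
move=> k l /fdiff_homog[e kE he]; exists e => //.
by rewrite /shift' kE addnAC.
Qed.

(** The invariant of the inductive construction: phi can be continued by at
    least one step, which is a condition on phi alone. *)
Definition liftable i (phi : 'M[{mpoly K[N]}]_(frank F' i, frank F i)) :=
  graded_mx (@shift' i) (fshift F i) phi /\
  forall k, exists w, row k (fdiff F' i *m phi) = w *m fdiff F i.

(** The square commutes and d' d' = 0, so the new component again satisfies
    the invariant, by exactness of the target. *)
Lemma lift_step i phi : liftable phi ->
  exists psi : 'M_(frank F' i.+1, frank F i.+1),
    liftable psi /\ psi *m fdiff F i = fdiff F' i *m phi.
Proof.
case=> gphi lphi.
have [psi gpsi psiE] := graded_lift (@graded_fdiff F i)
   (graded_mulmx (@graded_shift i) gphi) lphi.
exists psi; split=> //; split=> // k; have [_ _ exF] := resF.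
by apply/exF; rewrite -row_mul -mulmxA psiE mulmxA (fdiffK _ resF') mul0mx row0.
Qed.

Lemma lift_base : exists phi : 'M_(frank F' 0, frank F 0),
  liftable phi /\ forall k, J (faug F' k 0 * g - (phi *m faug F) k 0).
Proof.
have [surjF ex0F _] := resF; have [_ ex0F' _] := resF'; have [J0 JD JM _] := idJ.
have /fin_all_exists[u uP] k := surjF (faug F' k 0 * g).
pose phi := \matrix_k degpart_row (fshift F 0) (@shift' 0 k) (u k).
have phiJ k : J (faug F' k 0 * g - (phi *m faug F) k 0).
  have -> : (phi *m faug F) k 0 = degpart 0 (@shift' 0 k) ((u k *m faug F) 0 0).
    transitivity (row k (phi *m faug F) 0 0); first by rewrite [RHS]mxE.
    by rewrite row_mul rowK (degpart_rowM _ _ (@graded_faug F)) mxE.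
  have -> : faug F' k 0 * g = degpart 0 (@shift' 0 k) (faug F' k 0 * g).
    by rewrite (degpart_homog _ _ (dhomogM (faug_homog k) hg)) add0n eqxx.
  have := graded_ideal_degpart 0 (@shift' 0 k) idJ (uP k).
  by rewrite /degpart /= raddfB.
exists phi; split=> //; split=> [|k]; first exact: graded_mx_degpart.
apply/ex0F; rewrite -row_mul -mulmxA.
have J1 : J (((fdiff F' 0 *m faug F') k 0) * g).
  apply: J'J.
  have -> : (fdiff F' 0 *m faug F') k 0 = (row k (fdiff F' 0) *m faug F') 0 0.
    by rewrite -row_mul [RHS]mxE.
  by apply/ex0F'; exists (delta_mx 0 k); rewrite -rowE.
have -> : (row k (fdiff F' 0 *m (phi *m faug F))) 0 0
   = (fdiff F' 0 *m faug F') k 0 * g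
     + \sum_l - (fdiff F' 0 k l * (faug F' l 0 * g - (phi *m faug F) l 0)).
  rewrite mxE mxE [in RHS]mxE mulr_suml -big_split /=.
  by apply: eq_bigr => l _; rewrite mulrBr mulrA opprB addrC subrK.
apply: JD => //; apply: graded_ideal_sum => // l.
by apply: graded_idealN => //; apply: JM.
Qed.

(** Multiplication by g induces S/J' -> S/J; it lifts to a chain map between
    the resolutions that raises degrees by deg g. *)
Lemma comparison_map : exists phi : forall i, 'M_(frank F' i, frank F i),
  [/\ forall i, graded_mx (@shift' i) (fshift F i) (phi i),
      forall k, J (faug F' k 0 * g - (phi 0 *m faug F) k 0)
    & forall i, phi i.+1 *m fdiff F i = fdiff F' i *m phi i].
Proof.
have [phi0 [lphi0 phi0J]] := lift_base.
(* The components live in different types: carry the invariant in a subtype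
   and iterate a choice of next component. *)
pose T i := {phi : 'M_(frank F' i, frank F i) | liftable phi}.
have next i (x : T i) :
    {y : T i.+1 | proj1_sig y *m fdiff F i = fdiff F' i *m proj1_sig x}.
  apply: constructive_indefinite_description.
  by have [psi [lpsi psiE]] := lift_step (proj2_sig x); exists (exist _ psi lpsi).
pose x := nat_rect T (exist _ phi0 lphi0) (fun i y => proj1_sig (next i y)).
exists (fun i => proj1_sig (x i)); split=> // i; first by case: (x i) => ? [].
exact: (proj2_sig (next i (x i))).
Qed.

End Comparison.

(** * The mapping cone *)

Section MappingCone.
Variables (F F' : graded_free_seq K N) (d : nat).
Variable psi : forall i, 'M[{mpoly K[N]}]_(frank F' i, frank F i).
Hypothesis gpsi :
  forall i, graded_mx (fun k => fshift F' i k + d)%N (fshift F i) (psi i).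

Definition cone_rank i : nat :=
  if i is i'.+1 then (frank F i + frank F' i')%N else frank F 0.

Definition cone_shift i : 'I_(cone_rank i) -> nat :=
  match i return 'I_(cone_rank i) -> nat with
  | 0 => fshift F 0
  | i'.+1 => fun k => match split k with
      | inl k1 => fshift F i'.+1 k1
      | inr k2 => (fshift F' i' k2 + d)%N
      end
  end.

Definition cone_diff i : 'M[{mpoly K[N]}]_(cone_rank i.+1, cone_rank i) :=
  match i return 'M[{mpoly K[N]}]_(cone_rank i.+1, cone_rank i) with
  | 0 => col_mx (fdiff F 0) (psi 0)
  | i'.+1 => block_mx (fdiff F i'.+1) 0 (psi i'.+1) (- fdiff F' i')
  end.

Lemma cone_diff_graded i : graded_mx (@cone_shift i.+1) (@cone_shift i) (@cone_diff i).
Proof.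
case: i => [|i] k l /=.
  rewrite mxE; case: (split k) => k'; first exact: fdiff_homog.
  exact: gpsi.
rewrite mxE; case: (split k) => k'; rewrite mxE; case: (split l) => l'.
- exact: fdiff_homog.
- by rewrite mxE eqxx.
- exact: gpsi.
rewrite mxE oppr_eq0 => /fdiff_homog[e -> he].
by exists e; [rewrite addnAC | rewrite dhomogN].
Qed.

Definition cone : graded_free_seq K N :=
  @GradedFreeSeq K N cone_rank cone_shift cone_diff (faug F)
    cone_diff_graded (@faug_homog K N F).

Variables (J J' I : {mpoly K[N]} -> Prop) (f : {mpoly K[N]}).
Hypotheses (idJ : graded_ideal J).
Hypotheses (resF : resolution_of_quotient J F).
Hypotheses (resF' : resolution_of_quotient J' F').
Hypotheses (colon : forall p, J' p <-> J (p * f)).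
Hypotheses (sumE : forall p, I p <-> exists c, J (p - c * f)).
Hypothesis psi0 : forall k, J (faug F' k 0 * f - (psi 0 *m faug F) k 0).
Hypothesis psiS : forall i, psi i.+1 *m fdiff F i = fdiff F' i *m psi i.

Lemma psi0_row (u : 'rV_(frank F' 0)) :
  J ((u *m faug F') 0 0 * f - (u *m psi 0 *m faug F) 0 0).
Proof.
have [_ _ JM _] := idJ.
rewrite -mulmxA !mxE mulr_suml -sumrB; apply: graded_ideal_sum => // k.
by rewrite -mulrA -mulrBr; exact: JM.
Qed.

Lemma mul_cone_diff0 (w : 'rV_(frank F 1)) (w' : 'rV_(frank F' 0)) :
  row_mx w w' *m cone_diff 0 = w *m fdiff F 0 + w' *m psi 0.
Proof. exact: mul_row_col. Qed.

Lemma mul_cone_diffS i (w : 'rV_(frank F i.+2)) (w' : 'rV_(frank F' i.+1)) :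
  row_mx w w' *m cone_diff i.+1 =
  row_mx (w *m fdiff F i.+1 + w' *m psi i.+1) (- (w' *m fdiff F' i)).
Proof. by rewrite /= mul_row_block mulmx0 add0r mulmxN. Qed.

(** A cycle (u, u') has u' * psi in the image of F_1, so the colon condition
    makes u' a boundary; subtracting that boundary leaves a cycle of F. *)
Lemma cone_exact1 (u : 'rV_(frank F 1)) (u' : 'rV_(frank F' 0)) :
  row_mx u u' *m cone_diff 0 = 0 -> exists w, row_mx u u' = w *m cone_diff 1.
Proof.
have [_ ex0F exF] := resF; have [_ ex0F' _] := resF'; have [_ JD _ _] := idJ.
rewrite mul_cone_diff0 => /eqP; rewrite addr_eq0 => /eqP uE.
have [w' w'E] : exists w', u' = w' *m fdiff F' 0.
  apply/ex0F'/colon; rewrite -[_ * f](subrK ((u' *m psi 0 *m faug F) 0 0)).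
  apply: JD; first exact: psi0_row.
  by apply/ex0F; exists (- u); rewrite mulNmx uE opprK.
have [w wE] : exists w, u + w' *m psi 1 = w *m fdiff F 1.
  by apply/exF; rewrite mulmxDl uE -mulmxA psiS mulmxA -w'E addNr.
exists (row_mx w (- w')).
by rewrite mul_cone_diffS !mulNmx -wE addrK opprK w'E.
Qed.

(** Same argument as in degree 1, where exactness of the shifted resolution
    replaces the colon condition. *)
Lemma cone_exactS i (u : 'rV_(frank F i.+2)) (u' : 'rV_(frank F' i.+1)) :
  row_mx u u' *m cone_diff i.+1 = 0 -> exists w, row_mx u u' = w *m cone_diff i.+2.
Proof.
have [_ _ exF] := resF; have [_ _ exF'] := resF'.
rewrite mul_cone_diffS -row_mx0 => /eq_row_mx[/eqP].
rewrite addr_eq0 => /eqP uE /eqP; rewrite oppr_eq0 => /eqP/exF'[w' w'E].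
have [w wE] : exists w, u + w' *m psi i.+2 = w *m fdiff F i.+2.
  by apply/exF; rewrite mulmxDl uE -mulmxA psiS mulmxA -w'E addNr.
exists (row_mx w (- w')).
by rewrite mul_cone_diffS !mulNmx -wE addrK opprK w'E.
Qed.

Lemma cone_diffK i : cone_diff i.+1 *m cone_diff i = 0.
Proof.
case: i => [|i] /=.
  by rewrite mul_block_col (fdiffK _ resF) mul0mx psiS mulNmx addr0 subrr col_mx0.
rewrite mulmx_block -block_mx0; congr block_mx.
- by rewrite mul0mx addr0 (fdiffK _ resF).
- by rewrite mulmx0 mul0mx addr0.
- by rewrite psiS mulNmx subrr.
by rewrite mulmx0 add0r mulmxN mulNmx opprK (fdiffK _ resF').
Qed.

(** In degree 0, u maps into I = J + (f) exactly when it maps into J after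
    subtracting some multiple c f, that is, some element of the image of psi. *)
Lemma cone_resolution : resolution_of_quotient I cone.
Proof.
have [surjF ex0F exF] := resF; have [surjF' ex0F' exF'] := resF'.
have [J0 JD JM _] := idJ.
split.
- move=> p; have [u Ju] := surjF p; exists u; apply/sumE; exists 0.
  by rewrite mul0r subr0.
- move=> u; split=> [/sumE[c Jc]|[w ->]].
  + have [u' /colon Ju'] := surjF' c.
    have /ex0F[w wE] : J (((u - u' *m psi 0) *m faug F) 0 0).
      rewrite mulmxBl mxE [X in _ + X]mxE.
      set a := (u *m _) 0 0; set b := (_ *m faug F) 0 0.
      have -> : a - b = (a - c * f) + ((c - (u' *m faug F') 0 0) * f)
                       + ((u' *m faug F') 0 0 * f - b).
        by rewrite mulrBl !addrA subrK subrK.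
      by apply: (JD); [apply: (JD) | exact: psi0_row].
    by exists (row_mx w u'); rewrite /= mul_row_col -wE subrK.
  + rewrite -[w]hsubmxK mul_cone_diff0.
    set w1 := lsubmx w; set w2 := rsubmx w.
    apply/sumE; exists ((w2 *m faug F') 0 0); rewrite mulmxDl mxE -addrA.
    apply: JD; first by apply/ex0F; exists w1.
    by rewrite -opprB; apply: graded_idealN => //; exact: psi0_row.
- move=> i u; split=> [|[w ->]]; last by rewrite -mulmxA cone_diffK mulmx0.
  case: i u => [|i] u; rewrite -[u]hsubmxK; first exact: cone_exact1.
  exact: cone_exactS.
Qed.

Lemma cone_minimal : minimal_complex F -> minimal_complex F' ->
  (forall i k l, (psi i k l)@_0%MM = 0) -> minimal_complex cone.
Proof.
move=> minF minF' minpsi [|i] k l /=; rewrite mxE; case: (split k) => k' //.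
  by rewrite mxE; case: (split l) => l' //; rewrite mxE mcoeff0.
by rewrite mxE; case: (split l) => l' //; rewrite mxE mcoeffN minF' oppr0.
Qed.

End MappingCone.

(** Projective dimension a and regularity r read off from one minimal
    resolution.  Comparing shifts with i + r in nat avoids subtraction. *)
Definition pd_reg_quotient J (a r : nat) : Prop :=
  exists F, [/\ minimal_graded_free_resolution J F, (0 < frank F a)%N,
    exists i, exists k : 'I_(frank F i), fshift F i k = (i + r)%N
    & forall i (k : 'I_(frank F i)), (i <= a)%N /\ (fshift F i k <= i + r)%N].

(** The variable times a lift of g is a lift of the product with g, and it has no
    constant terms, so the cone is minimal and the Betti numbers add up.  That
    J' multiplies not only the product but already g into J follows when the
    variable is a nonzerodivisor modulo J. *)
Lemma pd_reg_cone J J' I x g a r a' r' dg :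
  graded_ideal J -> g \is dg.-homog ->
  (forall p, J' p <-> J (p * ('X_x * g))) -> (forall p, J' p -> J (p * g)) ->
  (forall p, I p <-> exists c, J (p - c * ('X_x * g))) ->
  pd_reg_quotient J a r -> pd_reg_quotient J' a' r' ->
  pd_reg_quotient I (maxn a a'.+1) (maxn r (r' + dg)).
Proof.
move=> idJ hg colon J'J sumE [F [[resF minF] aF rF boundF]].
move=> [F' [[resF' minF'] aF' rF' boundF']].
have [phi [gphi phi0 phiS]] := comparison_map idJ resF resF' hg J'J.
pose psi i := ('X_x : {mpoly K[N]}) *: phi i.
have gpsi i : graded_mx (fun k => fshift F' i k + dg.+1)%N (fshift F i) (psi i).
  move=> k l; rewrite mxE mulf_eq0 negb_or => /andP[_ /gphi[e ke he]].
  exists e.+1; first by rewrite !addnS ke.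
  by rewrite -add1n dhomogM // dhomogX; apply/eqP/mdeg1.
have psi0 k : J (faug F' k 0 * ('X_x * g) - (psi 0 *m faug F) k 0).
  have [_ _ JM _] := idJ; rewrite -scalemxAl mxE mulrCA -mulrBr; exact: JM.
have psiS i : psi i.+1 *m fdiff F i = fdiff F' i *m psi i.
  by rewrite -scalemxAl phiS scalemxAr.
exists (cone gpsi); split.
- split; first exact: (cone_resolution gpsi idJ resF resF' colon sumE psi0 psiS).
  apply: cone_minimal => // i k l.
  rewrite mxE (rmorphM (mcoeff 0%MM)) /= mcoeffX.
  have [/(congr1 mdeg)|_] := eqVneq; last by rewrite mul0r.
  by rewrite mdeg1 mdeg0.
- have [le_a|lt_a] := leqP a'.+1 a.
    by case: a le_a aF {boundF} => // a _ aF; rewrite addn_gt0 aF.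
  by rewrite addn_gt0 aF' orbT.
- have [le_r|lt_r] := leqP (r' + dg) r.
    have [[|i] [k kE]] := rF; first by exists 0%N, k.
    by exists i.+1, (unsplit (inl k)); rewrite /= (unsplitK (inl k)).
  have [i [k kE]] := rF'.
  by exists i.+1, (unsplit (inr k)); rewrite /= (unsplitK (inr k)) kE; lia.
move=> [|i] k /=; first by have [] := boundF 0%N k; lia.
by case: split => k'; [have [] := boundF _ k' | have [] := boundF' _ k']; lia.
Qed.

End GradedAlgebra.

(** * Squarefree monomial ideals *)

Section SquarefreeIdeals.
Local Open Scope ring_scope.
Variables (K : fieldType) (V : finType).
Implicit Types (p q : {mpoly K[#|V|]}) (m : 'X_{1..#|V|}) (A B S : {set V}).
Implicit Types P Q R : {set V} -> Prop.

Definition msupport m : {set V} := [set v | m (enum_rank v) != 0%N].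

Definition sqf_mnm B : 'X_{1..#|V|} := [multinom (enum_val i \in B : nat) | i < #|V|].

Definition upclosed P := forall A B, A \subset B -> P A -> P B.

(** For an upward closed P this is the ideal spanned by the monomials whose
    support satisfies P; every squarefree monomial ideal has this form.  Colon
    ideals and sums become operations on P. *)
Definition sqf_ideal P p := forall m, m \in msupp p -> P (msupport m).

Lemma msupportD m1 m2 : msupport (m1 + m2)%MM = msupport m1 :|: msupport m2.
Proof. by apply/setP => v; rewrite !inE mnmDE addn_eq0 negb_and. Qed.

Lemma msupport_sqf B : msupport (sqf_mnm B) = B.
Proof. by apply/setP => v; rewrite inE mnmE enum_rankK; case: (v \in B). Qed.

Lemma sqf_mnm_le B m : B \subset msupport m -> (sqf_mnm B <= m)%MM.
Proof.
move=> sB; apply/mnm_lepP => i; rewrite mnmE.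
case: (boolP (_ \in B)) => //= iB; have := subsetP sB _ iB.
by rewrite inE enum_valK lt0n.
Qed.

Lemma mdeg_sqf B : mdeg (sqf_mnm B) = #|B|.
Proof.
rewrite mdegE (reindex (@enum_rank V)); last exact/onW_bij/enum_rank_bij.
rewrite -sum1_card [RHS]big_mkcond; apply: eq_bigr => v _ /=.
by rewrite mnmE enum_rankK; case: (v \in B).
Qed.

Lemma sqf_mnmD1 B v : v \in B -> sqf_mnm B = (U_(enum_rank v) + sqf_mnm (B :\ v))%MM.
Proof.
move=> vB; apply/mnmP => i; rewrite mnmDE mnm1E !mnmE !inE.
have -> : (enum_rank v == i) = (enum_val i == v) 
  by rewrite -(inj_eq enum_val_inj) enum_rankK eq_sym.
by case: eqP => [->|]; rewrite ?vB.
Qed.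

Lemma prod_sqfE B :
  \prod_(v in B) ('X_(enum_rank v) : {mpoly K[#|V|]}) = 'X_[sqf_mnm B].
Proof.
rewrite mpolyXE_id (reindex (@enum_rank V)); last exact/onW_bij/enum_rank_bij.
rewrite big_mkcond; apply: eq_bigr => v _ /=.
by rewrite mnmE enum_rankK; case: (v \in B); rewrite ?expr1 ?expr0.
Qed.

Lemma sqf_graded_ideal P : upclosed P -> graded_ideal (sqf_ideal P).
Proof.
move=> upP; split.
- by move=> m; rewrite msupp0.
- move=> p q Pp Pq m /msuppD_le; rewrite mem_cat => /orP[]; [exact: Pp|exact: Pq].
- move=> c p Pp m /msuppM_le/allpairsP[[m1 m2] [_ /= /Pp Pm2 ->]].
  by apply: upP Pm2; rewrite msupportD subsetUr.
move=> e p Pp m; rewrite pihomogE => /msupp_sum_le/flatten_mapP[m'].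
by rewrite mem_filter => /andP[_ /Pp Pm'] /msuppZ_le; rewrite msuppX inE => /eqP->.
Qed.

Lemma sqf_idealX P m : sqf_ideal P 'X_[m] <-> P (msupport m).
Proof.
by split=> [|Pm m']; [apply; rewrite msuppX inE | rewrite msuppX inE => /eqP->].
Qed.

Lemma sqf_ideal_iff P Q : (forall S, P S <-> Q S) ->
  forall p, sqf_ideal P p <-> sqf_ideal Q p.
Proof. by move=> PQ p; split=> Hp m /Hp/PQ. Qed.

Lemma sqf_colon P m p :
  sqf_ideal P (p * 'X_[m]) <-> sqf_ideal (fun S => P (S :|: msupport m)) p.
Proof.
split=> Hp m'.
  move=> m'p; rewrite -msupportD addmC; apply: Hp.
  by rewrite (perm_mem (msuppMX _ _)) map_f.
rewrite (perm_mem (msuppMX _ _)) => /mapP[m1 /Hp Hm1 ->].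
by rewrite addmC msupportD.
Qed.

(** Assign each monomial of p that is divisible by some generator to one such
    generator; the monomials left over satisfy P. *)
Lemma sqf_ideal_sum (I : finType) (B : I -> {set V}) P p : upclosed P ->
  sqf_ideal (fun S => P S \/ exists i, B i \subset S) p <->
  exists c : I -> {mpoly K[#|V|]}, sqf_ideal P (p - \sum_i c i * 'X_[sqf_mnm (B i)]).
Proof.
move=> upP; split=> [Hp|[c Hc]]; last first.
  set R := fun S => _.
  have upR : upclosed R.
    move=> A A' sAA' [/(upP _ _ sAA')|[i sBA]]; first by left.
    by right; exists i; exact: subset_trans sAA'.
  have idR := sqf_graded_ideal upR; have [_ RD RM _] := idR.
  rewrite -(subrK (\sum_i c i * 'X_[sqf_mnm (B i)]) p); apply: RD.
    by move=> m /Hc; left.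
  apply: (graded_ideal_sum idR) => i; apply: RM; apply/sqf_idealX.
  by right; exists i; rewrite msupport_sqf.
pose gen m := [pick i | B i \subset msupport m].
pose c i := \sum_(m <- msupp p | gen m == Some i) p@_m *: 'X_[m - sqf_mnm (B i)].
exists c.
have -> : \sum_i c i * 'X_[sqf_mnm (B i)] =
    \sum_(m <- msupp p | gen m != None) p@_m *: 'X_[m].
  rewrite (partition_big gen (fun o => o != None)) //=.
  rewrite (reindex_omap Some id) /=; last by case.
  rewrite [RHS](eq_bigl xpredT) => [|i]; last by rewrite eqxx.
  apply: eq_bigr => i _; rewrite mulr_suml [RHS]big_mkcond [LHS]big_mkcond.
  apply: eq_bigr => m _; rewrite /gen; case: pickP => [j sB|_] //=.
  rewrite (inj_eq Some_inj); case: eqP => // <-.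
  by rewrite -scalerAl -mpolyXD submK // sqf_mnm_le.
rewrite [X in X - _](mpolyE p) [X in X - _](bigID (fun m => gen m != None)) /=.
rewrite [X in X - _]addrC addrK.
move=> m /msupp_sum_le/flatten_mapP[m']; rewrite mem_filter negbK => /andP[gN m'p].
move=> /msuppZ_le; rewrite msuppX inE => /eqP->.
case: (Hp _ m'p) => // -[i sB]; move: gN; rewrite /gen.
by case: pickP => // /(_ i); rewrite sB.
Qed.

Lemma pd_reg_ext (J J' : {mpoly K[#|V|]} -> Prop) a r :
  (forall p, J p <-> J' p) -> pd_reg_quotient J a r -> pd_reg_quotient J' a r.
Proof.
move=> JJ' [F [[[surj ex0 exS] minF] aF rF bF]]; exists F; split=> //; split=> //.
split=> // [p|u]; first by have [u /JJ'] := surj p; exists u.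
by rewrite -ex0; split=> /JJ'.
Qed.

(** The monomial B contributes a variable v on which P does not depend, hence a
    nonzerodivisor; Q describes the colon ideal and R the sum. *)
Lemma pd_reg_add_monomial P Q R B v a r a' r' :
  upclosed P -> v \in B -> (forall S, P (v |: S) -> P S) ->
  (forall S, Q S <-> P (S :|: B)) -> (forall S, R S <-> P S \/ B \subset S) ->
  pd_reg_quotient (sqf_ideal P) a r -> pd_reg_quotient (sqf_ideal Q) a' r' ->
  pd_reg_quotient (sqf_ideal R) (maxn a a'.+1) (maxn r (r' + #|B|.-1)).
Proof.
move=> upP vB Pv QP RP.
have XE : 'X_[sqf_mnm B] = 'X_(enum_rank v) * 'X_[sqf_mnm (B :\ v)] :> {mpoly K[#|V|]}.
  by rewrite -mpolyXD -sqf_mnmD1.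
apply: (@pd_reg_cone _ _ _ _ _ (enum_rank v) 'X_[sqf_mnm (B :\ v)]).
- exact: sqf_graded_ideal.
- by rewrite dhomogX; apply/eqP/(etrans (mdeg_sqf _)); rewrite (cardsD1 v B) vB.
- move=> p; rewrite -XE sqf_colon msupport_sqf; exact: sqf_ideal_iff.
- move=> p Qp; apply/sqf_colon; rewrite msupport_sqf => m /Qp/QP PB.
  by apply: Pv; rewrite setUCA setD1K.
move=> p; rewrite -XE (sqf_ideal_iff (Q := fun S => P S \/ exists i : 'I_1, B \subset S)).
  rewrite sqf_ideal_sum //; split=> [[c]|[c Hc]].
    by rewrite big_ord1; exists (c 0).
  by exists (fun=> c); rewrite big_ord1.
move=> S; rewrite RP; split=> [[]|[|[]]]; auto.
by right; exists 0.
Qed.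

Definition free_seq1 : graded_free_seq K #|V|.
Proof.
refine (@GradedFreeSeq K #|V| (fun i => (i == 0)%N) (fun _ _ => 0%N)
          (fun=> 0) (const_mx 1) _ _).
- by move=> i k l; rewrite mxE eqxx.
- by move=> k; rewrite mxE; exact: dhomog1.
Defined.

Lemma pd_reg_zero : pd_reg_quotient (sqf_ideal (fun=> False)) 0 0.
Proof.
have sqf0 p : sqf_ideal (fun=> False) p <-> p = 0.
  rewrite /sqf_ideal; split=> [p0|-> m]; last by rewrite msupp0.
  by apply: msuppnil0; case: msupp p0 => // m s /(_ m); rewrite inE eqxx => /(_ isT).
have augE (u : 'rV_(frank free_seq1 0)) :
    (u *m faug free_seq1) 0 0 = u 0 0.
  by rewrite mxE big_ord1 mxE mulr1.
exists free_seq1; split=> //; last by case=> [|i] [].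
- split; last by move=> i k l; rewrite mxE mcoeff0.
  split=> [p|u|i u].
  + by exists (const_mx p); apply/sqf0; rewrite augE mxE subrr.
  + rewrite sqf0 augE; split=> [u0|[w ->]]; last by rewrite mulmx0 mxE.
    by exists 0; rewrite mul0mx; apply/rowP => k; rewrite (ord1 k) mxE.
  + split=> _; last by rewrite mulmx0.
    by exists 0; apply/rowP; case.
by exists 0%N, ord0.
Qed.

Lemma pd_reg_principal P B : (0 < #|B|)%N -> (forall S, P S <-> B \subset S) ->
  pd_reg_quotient (sqf_ideal P) 1 #|B|.-1.
Proof.
case/card_gt0P => v vB PB.
have := @pd_reg_add_monomial (fun=> False) (fun=> False) P B v 0 0 0 0.
rewrite !max0n add0n; apply=> //.
- by move=> S; rewrite PB; split; auto; case.
- exact: pd_reg_zero.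
- exact: pd_reg_zero.
Qed.

Lemma ideal_generated_sqf (I : finType) (B : I -> {set V}) p :
  ideal_generated (fun i => \prod_(v in B i) ('X_(enum_rank v) : {mpoly K[#|V|]})) p <->
  sqf_ideal (fun S => exists i, B i \subset S) p.
Proof.
rewrite (sqf_ideal_iff (Q := fun S => False \/ exists i, B i \subset S)); last first.
  by move=> S; split; auto; case.
rewrite sqf_ideal_sum //; split=> -[c Hc]; exists c.
  have -> : p = \sum_i c i * 'X_[sqf_mnm (B i)].
    by rewrite Hc; apply: eq_bigr => i _; rewrite prod_sqfE.
  by rewrite subrr => m; rewrite msupp0.
have /eqP : p - \sum_i c i * 'X_[sqf_mnm (B i)] = 0.
  apply: msuppnil0; move: Hc; rewrite /sqf_ideal; case: msupp => // m s /(_ m).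
  by rewrite inE eqxx => /(_ isT).
rewrite subr_eq0 => /eqP->; apply: eq_bigr => i _.
by rewrite prod_sqfE.
Qed.

End SquarefreeIdeals.

(** * The ideals of intervals in the broom *)

Section BroomSquare.
Local Open Scope nat_scope.
Variables (K : fieldType) (n m : nat).
Local Notation V := (broom_vertex n m).
Implicit Types S : {set V}.

Definition has_xs S : Prop := forall i : 'I_n, inl i \in S.

(** Indices beyond the last y-vertex impose no condition, so intervals may run
    over the right end. *)
Definition has_ys a b S : Prop := forall j : 'I_m, a <= j < b -> inr j \in S.

Definition yset a b : {set V} :=
  [set u : V | match u with inl _ => false | inr j => a <= j < b end].
Definition xyset c : {set V} :=
  [set u : V | match u with inl _ => true | inr j => j < c end].

Lemma subset_yset a b S : yset a b \subset S <-> has_ys a b S.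
Proof.
split=> [/subsetP sS j jab|hS]; first by apply: sS; rewrite inE.
by apply/subsetP => -[i|j]; rewrite inE // => /hS.
Qed.

Lemma subset_xyset c S : xyset c \subset S <-> has_xs S /\ has_ys 0 c S.
Proof.
split=> [/subsetP sS|[hx hy]].
  by split=> [i|j jc]; apply: sS; rewrite inE.
by apply/subsetP => -[i|j]; rewrite inE => // jc; exact: hy.
Qed.

Lemma card_yset a b : b <= m -> #|yset a b| = b - a.
Proof.
elim: b => [_|b IHb ltbm].
  by apply/eqP; rewrite cards_eq0; apply/eqP/setP => -[i|j]; rewrite !inE ?andbF.
have [leab|ltba] := leqP a b; last first.
  rewrite (_ : b.+1 - a = 0); last by lia.
  by apply/eqP; rewrite cards_eq0; apply/eqP/setP => -[i|j]; rewrite !inE //; lia.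
have -> : yset a b.+1 = inr (Ordinal ltbm) |: yset a b.
  apply/setP => -[i|j]; rewrite !inE //.
  by rewrite (inj_eq inr_inj) -val_eqE /=; lia.
by rewrite cardsU1 IHb ?inE /=; lia.
Qed.

Lemma card_xyset c : c <= m -> #|xyset c| = n + c.
Proof.
elim: c => [_|c IHc ltcm].
  rewrite addn0 -[RHS]card_ord -(card_imset _ (@inl_inj 'I_n 'I_m)).
  apply/eq_card => -[i|j]; rewrite !inE.
    by apply/esym/imsetP; exists i.
  by apply/esym/imsetP => -[].
have -> : xyset c.+1 = inr (Ordinal ltcm) |: xyset c.
  apply/setP => -[i|j]; rewrite !inE //.
  by rewrite (inj_eq inr_inj) -val_eqE /=; lia.
by rewrite cardsU1 IHc ?inE /=; lia.
Qed.

(** The supports of the monomials in W_k. *)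
Definition windows k S : Prop :=
  has_xs S /\ has_ys 0 2 S \/ exists2 j, j < k & has_ys j (j + 5) S.

(** The supports of the monomials in D_c.  For c = 3 and c = 4 truncated
    subtraction makes windows (c - 5) the x-interval alone. *)
Definition broom_gens c S : Prop :=
  if c < 3 then has_xs S /\ has_ys 0 c S
  else windows (c - 5) S \/ has_ys (c - 3) c S.

Lemma upclosed_windows k : upclosed (windows k).
Proof.
move=> A B /subsetP sAB [[hx hy]|[j ltjk hj]].
  by left; split=> [i|j jc]; apply: sAB; auto.
by right; exists j => // i ij; apply/sAB/hj.
Qed.

Lemma has_xsU S c d : has_xs (S :|: yset c d) <-> has_xs S.
Proof.
by split=> hx i; have := hx i; rewrite !inE ?orbF // => ->.
Qed.

Lemma has_ysU S a b c d : has_ys a b (S :|: yset c d) <->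
  forall j : 'I_m, a <= j < b -> c <= j < d \/ inr j \in S.
Proof.
split=> h j /h; rewrite !inE; first by case/orP; auto.
by case=> ->; rewrite ?orbT.
Qed.

(** The first window meets the x-interval in y_0 and y_1, so the x's remain. *)
Lemma windows_colon0 S : windows 0 (S :|: yset 0 5) <-> has_xs S.
Proof.
split=> [[[/has_xsU//]|[]//]|hx]; left; split; first exact/has_xsU.
by apply/has_ysU => j jc; left; lia.
Qed.

(** A window starting at j with k - 5 <= j < k, or the x-interval when k < 3,
    still requires y_(k-1) after the colon; the window starting at k - 1
    requires nothing else.  All other generators are disjoint from the window
    at k. *)
Lemma windows_colon k S : 0 < k -> k + 4 < m ->
  windows k (S :|: yset k (k + 5)) <->
  windows (k - 5) S \/ yset k.-1 k \subset S.
Proof.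
move=> k_gt0 ltkm; rewrite subset_yset; split.
  move=> [[/has_xsU hx /has_ysU hy]|[j ltjk /has_ysU hj]].
    have [le3k|ltk3] := leqP 3 k.
      left; left; split=> // j jc; have [|//] := hy j jc; lia.
    right=> j jc; have [||//] := hy j; lia.
  have [lek|ltj] := leqP (k - 5) j.
    right=> i ic; have [||//] := hj i; lia.
  left; right; exists j => // i ic; have [|//] := hj i ic; lia.
case=> [[[hx hy]|[j ltj hj]]|hy].
- by left; split; [exact/has_xsU | apply/has_ysU => j /hy; right].
- right; exists j; first by lia.
  by apply/has_ysU => i /hj; right.
right; exists k.-1; first by lia.
apply/has_ysU => j jc; have [kj|ltjk] := leqP k j; first by left; lia.
right; apply: hy; lia.
Qed.

(** The window starting at c - 6 leaves y_(c-6), y_(c-5), y_(c-4), which any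
    other window meeting the triple still requires.  For c < 6 the x-interval
    plays this part. *)
Lemma broom_colon c S : 3 <= c -> c <= m ->
  windows (c - 5) (S :|: yset (c - 3) c) <-> broom_gens (c - 3) S.
Proof.
move=> le3c lecm; rewrite /broom_gens; case: ltnP => c6.
  split=> [[[/has_xsU hx /has_ysU hy]|[j ltj /has_ysU hj]]|[hx hy]].
  - split=> // j jc; have [||//] := hy j; lia.
  - lia.
  - left; split; first exact/has_xsU.
    apply/has_ysU => j jc; have [le|lt] := leqP (c - 3) j; first by left; lia.
    right; apply: hy; lia.
split=> [[[/has_xsU hx /has_ysU hy]|[j ltj /has_ysU hj]]|].
- left; left; split=> // j jc; have [|//] := hy j jc; lia.
- have [le|lt] := leqP (c - 8) j.
    right=> i ic; have [||//] := hj i; lia.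
  left; right; exists j; first by lia.
  move=> i ic; have [|//] := hj i ic; lia.
case=> [[[hx hy]|[j ltj hj]]|hy].
- by left; split; [exact/has_xsU | apply/has_ysU => j /hy; right].
- right; exists j; first by lia.
  by apply/has_ysU => i /hj; right.
right; exists (c - 6); first by lia.
apply/has_ysU => j jc; have [kj|ltjk] := leqP (c - 3) j; first by left; lia.
right; apply: hy; lia.
Qed.

Lemma windows_indep k (v : 'I_m) S : 2 <= v -> (0 < k -> k + 4 <= v) ->
  windows k (inr v |: S) -> windows k S.
Proof.
have vN (j : 'I_m) : j < v -> inr j \in inr v |: S -> inr j \in S.
  by move=> ltjv; rewrite !inE (inj_eq inr_inj) -val_eqE /= ltn_eqF.
move=> v2 kv [[hx hy]|[j ltj hj]].
  left; split=> [i|j jc]; first by have := hx i; rewrite !inE.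
  by apply: vN (hy j jc); lia.
by right; exists j => // i ic; apply: vN (hj i ic); lia.
Qed.

(** * The recursions for projective dimension and regularity *)

Hypotheses (n_ge2 : 2 <= n) (m_ge2 : 2 <= m).

Lemma pd_reg_xy c P : c <= m -> (forall S, P S <-> has_xs S /\ has_ys 0 c S) ->
  pd_reg_quotient (@sqf_ideal K V P) 1 (n + c).-1.
Proof.
move=> lecm PE; rewrite -(card_xyset lecm); apply: pd_reg_principal.
  rewrite card_xyset //; lia.
by move=> S; rewrite PE subset_xyset.
Qed.

Lemma windowsS k S : windows k.+1 S <-> windows k S \/ yset k (k + 5) \subset S.
Proof.
rewrite subset_yset; split=> [[hA|[j ltj hj]]|[[hA|[j ltj hj]]|hk]].
- by left; left.
- move: ltj; rewrite ltnS leq_eqVlt => /predU1P[jk|ltjk]; last by left; right; exists j.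
  by right; rewrite -jk.
- by left.
- by right; exists j => //; lia.
by right; exists k.
Qed.

(** Upper bounds suffice, and indexing by the c of the ideal D_c in which these
    windows occur makes the bound exactly the value for D_c. *)
Lemma windows_pd_reg c : 3 <= c <= m -> exists a r,
  [/\ pd_reg_quotient (@sqf_ideal K V (windows (c - 5))) a r,
      a <= c %/ 3 + 1 & r <= n.-1 + (2 * (c %/ 3) + c %% 3)].
Proof.
elim/ltn_ind: c => c IH /andP[c3 cm].
have [c5|c5] := leqP c 5.
  exists 1, (n + 2).-1; split; try lia.
  apply: pd_reg_xy => // S; rewrite (_ : c - 5 = 0); last by lia.
  by split=> [[//|[]//]|]; left.
have [||a [r [IHF IHa IHr]]] := IH c.-1; try lia.
set k := c.-1 - 5 in IHF; have -> : c - 5 = k.+1 by lia.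
have km : k + 4 < m by lia.
suff [a' [r' [Q [QF Qa Qr QE]]]] : exists a' r' Q,
    [/\ pd_reg_quotient (@sqf_ideal K V Q) a' r',
    a' <= c %/ 3, r' + 4 <= n.-1 + (2 * (c %/ 3) + c %% 3)
    & forall S, Q S <-> windows k (S :|: yset k (k + 5))].
  exists (maxn a a'.+1), (maxn r (r' + #|yset k (k + 5)|.-1)); split.
  - apply: (@pd_reg_add_monomial _ _ (windows k) Q _ _ (inr (Ordinal km))) => //.
    + exact: upclosed_windows.
    + by rewrite inE /=; lia.
    + by move=> S; apply: windows_indep => /=; lia.
    + exact: windowsS.
  - lia.
  - rewrite card_yset; lia.
(* The colon ideal is principal for k <= 2: the first window leaves the x's,
   and for k = 1, 2 the variable y_(k-1) divides the x-interval. *)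
have [k0|k_gt0] := posnP k.
  exists 1, (n + 0).-1, has_xs; split; try lia.
    by apply: pd_reg_xy => // S; split=> [|[]//]; split=> // j; lia.
  by move=> S; rewrite k0 windows_colon0.
have yE : #|yset k.-1 k| = 1 by rewrite card_yset; lia.
have [k3|k3] := leqP k 2.
  exists 1, 0, (fun S => yset k.-1 k \subset S); split; try lia.
    have := @pd_reg_principal K V (fun S => yset k.-1 k \subset S) (yset k.-1 k).
    by rewrite yE; apply.
  move=> S; rewrite windows_colon //; split; first by right.
  case=> [[[_ hy]|[j]]|//]; last by lia.
  by apply/subset_yset => j jc; apply: hy; lia.
(* Here y_(k-1) is a variable outside W_(k-5): adding it raises pd by 1 and
   does not change reg. *)
have [||a' [r' [IHF' IHa' IHr']]] := IH (c - 6); try lia.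
exists (maxn a' a'.+1), (maxn r' (r' + #|yset k.-1 k|.-1)),
   (fun S => windows (k - 5) S \/ yset k.-1 k \subset S); split; try lia.
  have k1m : k.-1 < m by lia.
  rewrite (_ : c - 6 - 5 = k - 5) in IHF'; last by lia.
  apply: (@pd_reg_add_monomial _ _ (windows (k - 5)) (windows (k - 5)) _ _
    (inr (Ordinal k1m))) => //.
  - exact: upclosed_windows.
  - by rewrite inE /=; lia.
  - by move=> S; apply: windows_indep => /=; lia.
  - move=> S; split; first by apply: upclosed_windows; exact: subsetUl.
    have -> : yset k.-1 k = [set inr (Ordinal k1m)].
      by apply/setP => -[i|j]; rewrite !inE // (inj_eq inr_inj) -val_eqE /=; lia.
    by rewrite setUC; apply: windows_indep => /=; lia.
by move=> S; rewrite windows_colon.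
Qed.

Lemma broom_pd_reg c : c <= m ->
  pd_reg_quotient (@sqf_ideal K V (broom_gens c)) (c %/ 3 + 1)
    (n.-1 + (2 * (c %/ 3) + c %% 3)).
Proof.
elim/ltn_ind: c => c IH cm.
have [c3|c3] := ltnP c 3.
  have pdE : c %/ 3 + 1 = 1 by lia.
  have regE : n.-1 + (2 * (c %/ 3) + c %% 3) = (n + c).-1 by lia.
  rewrite pdE regE; by apply: pd_reg_xy => // S; rewrite /broom_gens c3.
have [|a [r [JF Ja Jr]]] := @windows_pd_reg c; first by rewrite c3.
have lt_c3 : c - 3 < c by lia.
have DF := IH _ lt_c3 (leq_trans (leq_subr 3 c) cm).
have cB : #|yset (c - 3) c| = 3 by rewrite card_yset // subKn.
have pdE : c %/ 3 + 1 = maxn a ((c - 3) %/ 3 + 1).+1 by clear -Ja c3; lia.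
have regE : n.-1 + (2 * (c %/ 3) + c %% 3) =
    maxn r (n.-1 + (2 * ((c - 3) %/ 3) + (c - 3) %% 3) + #|yset (c - 3) c|.-1).
  by rewrite cB; clear -Jr c3; lia.
rewrite pdE regE.
have c1 : c.-1 < m by lia.
apply: (@pd_reg_add_monomial _ _ (windows (c - 5)) (broom_gens (c - 3)) _ _
  (inr (Ordinal c1))) => //.
- exact: upclosed_windows.
- by rewrite inE /=; lia.
- by move=> S; apply: windows_indep => /=; lia.
- by move=> S; rewrite broom_colon.
by move=> S; rewrite /broom_gens ltnNge c3 /= subset_yset.
Qed.

(** * The closed neighborhood ideal *)

Lemma closed_nbhd_x (i : 'I_n) S :
  closed_nbhd (broom_sq n m) (inl i) \subset S <-> has_xs S /\ has_ys 0 2 S.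
Proof.
rewrite -subset_xyset; suff -> : closed_nbhd (broom_sq n m) (inl i) = xyset 2 by [].
apply/setP => -[i'|j]; rewrite !inE /broom_sq /broom /sym_closure /=.
  by rewrite (inj_eq inl_inj) -val_eqE /=; lia.
lia.
Qed.

Lemma closed_nbhd_y (j : 'I_m) S :
  closed_nbhd (broom_sq n m) (inr j) \subset S <->
  (j < 2 -> has_xs S) /\ has_ys (j - 2) (j + 3) S.
Proof.
have xE i : (inl i \in closed_nbhd (broom_sq n m) (inr j)) = (j < 2).
  by rewrite !inE /broom_sq /broom /sym_closure /=; lia.
have yE k : (inr k \in closed_nbhd (broom_sq n m) (inr j)) = (j - 2 <= k < j + 3).
  by rewrite !inE /broom_sq /broom /sym_closure /= (inj_eq inr_inj) -val_eqE /=; lia.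
split=> [/subsetP sS|[hx hy]].
  by split=> [j2 i|k jk]; apply: sS; rewrite ?xE ?yE.
by apply/subsetP => -[i|k]; rewrite ?xE ?yE; [move/hx; exact | exact: hy].
Qed.

(** The neighbourhoods of the x's are the x-interval, which divides those of the
    first two y's; near the right end the neighbourhood of the last vertex
    divides the others. *)
Lemma NI_gens S :
  (exists u, closed_nbhd (broom_sq n m) u \subset S) <-> broom_gens m S.
Proof.
have hA : has_xs S /\ has_ys 0 2 S -> broom_gens m S.
  rewrite /broom_gens; case: ltnP => m3 hA; last by left; left.
  by rewrite (_ : m = 2); last by lia.
have n_gt0 : 0 < n by lia.
split=> [[[i|j]]|].
- by move/closed_nbhd_x.
- move=> /closed_nbhd_y[hx hy].
  have [j2|j2] := ltnP j 2.
    by apply: hA; split; [exact: hx | move=> k k2; apply: hy; lia].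
  rewrite /broom_gens ltnNge (leq_ltn_trans j2 (ltn_ord j)) /=.
  have [mj|mj] := leqP (m - 3) j; first last.
    left; right; exists (j - 2); first by lia.
    by move=> k kj; apply: hy; lia.
  by right=> k km; apply: hy; have := ltn_ord j; lia.
rewrite /broom_gens; case: ltnP => m3.
  move=> [hx hy]; exists (inl (Ordinal n_gt0)); apply/closed_nbhd_x; split=> // j j2.
  by apply: hy; lia.
case=> [[hA'|[j ltj hj]]|hy].
- by exists (inl (Ordinal n_gt0)); apply/closed_nbhd_x.
- have jm : j + 2 < m by lia.
  exists (inr (Ordinal jm)); apply/closed_nbhd_y; split=> /=; first by lia.
  by move=> k kj; apply: hj; lia.
have mm : m.-1 < m by lia.
exists (inr (Ordinal mm)); apply/closed_nbhd_y; split=> /=; first by lia.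
by move=> k kj; apply: hy; have := ltn_ord k; lia.
Qed.

Lemma NI_pd_reg : pd_reg_quotient (NI K (broom_sq n m)) (m %/ 3 + 1)
  (n.-1 + (2 * (m %/ 3) + m %% 3)).
Proof.
apply: pd_reg_ext (broom_pd_reg (leqnn m)) => p.
by rewrite /NI ideal_generated_sqf; apply: sqf_ideal_iff => S; rewrite NI_gens.
Qed.

End BroomSquare.

Lemma pd_quotient_isP (K : fieldType) N (J : {mpoly K[N]} -> Prop) a r :
  pd_reg_quotient J a r -> pd_quotient_is J a.
Proof.
move=> [F [resF aF _ bF]]; exists F => //; split.
  exists (fshift F a (Ordinal aF)); rewrite -lt0n; apply/card_gt0P.
  by exists (Ordinal aF); rewrite inE.
move=> i [j]; rewrite -lt0n => /card_gt0P[k _].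
by have [] := bF i k.
Qed.

Lemma reg_quotient_isP (K : fieldType) N (J : {mpoly K[N]} -> Prop) a r :
  pd_reg_quotient J a r -> reg_quotient_is J (Posz r).
Proof.
move=> [F [resF _ [i [k kE]] bF]]; exists F => //; split.
  exists i, (i + r)%N; split; last by lia.
  by rewrite -lt0n; apply/card_gt0P; exists k; rewrite inE kE.
move=> s [i' [j [nz ->]]]; move: nz; rewrite -lt0n => /card_gt0P[k'].
by rewrite inE => /eqP <-; have [_] := bF i' k'; lia.
Qed.

Theorem theorem3p7 (K : fieldType) (n m p d : nat) :
  (2 <= n)%N -> (2 <= m)%N -> (m - 2 = 6 * p + d)%N -> (d <= 5)%N ->
  reg_quotient_is (NI K (broom_sq n m))
    (Posz (if (d <= 1)%N then 4 * p + n + 1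
           else if d == 2 then 4 * p + n + 2
           else if (d <= 4)%N then 4 * p + n + 3
           else 4 * p + n + 4)%N)
  /\
  pd_quotient_is (NI K (broom_sq n m))
    (if d == 0 then 2 * p + 1
     else if (d <= 3)%N then 2 * p + 2
     else 2 * p + 3)%N.
Proof.
move=> n2 m2 mE d5; have NIF := NI_pd_reg K n2 m2; split.
  rewrite [X in Posz X](_ : _ = n.-1 + (2 * (m %/ 3) + m %% 3))%N.
    exact: reg_quotient_isP NIF.
  by case: d mE d5 {NIF} => [|[|[|[|[|[|//]]]]]] mE _ /=; lia.
rewrite [X in pd_quotient_is _ X](_ : _ = m %/ 3 + 1)%N.
  exact: pd_quotient_isP NIF.
by case: d mE d5 {NIF} => [|[|[|[|[|[|//]]]]]] mE _ /=; lia.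
Qed.
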